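(* Let $X\subseteq S^1$ and $0<r<\frac12$. Define $$T_r(X)=\tfrac{1}{1+2r}X\ \cup\ \Big(\tfrac{1}{1+2r}\big(X\cap[0,2r)_{S^1}\big)+\tfrac{1}{1+2r}\Big),$$ and let $\pi_r:S^1\to S^1$ be the (non-continuous) map $\pi_r(y)=(1+2r)y\bmod 1$ for $y\in[0,1)$. Then $\pi_r$ maps $T_r(X)$ onto $X$ and induces a simplicial map $$\pi_r:\mathbf{VR}_{\le}\Big(T_r(X);\tfrac{2r}{1+2r}\Big)\to\check{\mathbf C}_{\le}(X;r)$$ which is a homotopy equivalence.
   Context: $S^1$ is the circle of circumference $1$ with the arc-length metric; each point is identified with a number in $[0,1)$, and for $X\subseteq S^1$ and $a,b\in\mathbb R$, $aX+b=\{(ax+b)\bmod 1: x\in X\}$ with $x$ represented in $[0,1)$. $[0,2r)_{S^1}$ is the half-open clockwise arc from $0$ to $2r$. $\mathbf{VR}_{\le}(Y;s)$ is the Vietoris–Rips complex: vertex set $Y$, faces the finite subsets of diameter at most $s$. $\check{\mathbf C}_{\le}(X;r)$ is the Čech complex: vertex set $X$, and a finite $\sigma\subseteq X$ is a face iff the closed balls of radius $r$ in $S^1$ about the points of $\sigma$ have a common point (equivalently $\sigma$ lies in a closed arc of length $2r$). Complexes carry the CW (weak) topology. *)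

(* Defs.v *)
From HB Require Import structures.
From mathcomp Require Import all_boot all_order all_algebra.
From mathcomp Require Import boolp classical_sets functions cardinality fsbigop reals.
Set Implicit Arguments. Unset Strict Implicit. Unset Printing Implicit Defensive.
Import Order.TTheory GRing.Theory Num.Theory.
Local Open Scope classical_set_scope.
Local Open Scope ring_scope.

Section Defs.
Variable R : realType.

(** * The circle S^1 of circumference 1, points identified with [0,1). *)
Definition on_circle (x : R) : Prop := 0 <= x /\ x < 1.

Definition mod1 (x : R) : R := x - (Num.floor x)%:~R.

(** arc-length (geodesic) distance on S^1, for x, y in [0,1) *)
Definition circ_dist (x y : R) : R := Num.min `|x - y| (1 - `|x - y|).

Definition scale_shift (a b : R) (X : set R) : set R :=
  [set mod1 (a * x + b) | x in X].

Definition arc0 (l : R) : set R := [set x | 0 <= x /\ x < l].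

Definition T_r (r : R) (X : set R) : set R :=
  scale_shift (1 + 2 * r)^-1 0 X `|`
  scale_shift (1 + 2 * r)^-1 (1 + 2 * r)^-1 (X `&` arc0 (2 * r)).

Definition pi_r (r : R) (y : R) : R := mod1 ((1 + 2 * r) * y).

(** * Abstract simplicial complexes with vertices in R:
    a complex is given by its set of faces (finite nonempty sets of vertices). *)
Definition complex := set (set R).

Definition VR (Y : set R) (s : R) : complex :=
  [set sigma | [/\ finite_set sigma, sigma !=set0, sigma `<=` Y &
     forall x y, sigma x -> sigma y -> circ_dist x y <= s]].

Definition Cech (X : set R) (r : R) : complex :=
  [set sigma | [/\ finite_set sigma, sigma !=set0, sigma `<=` X &
     exists p, on_circle p /\ forall x, sigma x -> circ_dist x p <= r]].

Definition simplicial (K L : complex) (phi : R -> R) : Prop :=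
  forall sigma, K sigma -> L (phi @` sigma).

(** * Geometric realization |K|: finitely supported barycentric coordinates
    f : R -> R whose support is a face, f >= 0, sum f = 1. *)
Definition supp (f : R -> R) : set R := [set v | f v != 0].

Definition realization (K : complex) : set (R -> R) :=
  [set f | [/\ K (supp f), (forall v, 0 <= f v) &
              \sum_(v \in [set: R]) f v = 1]].

(** The CW (weak) topology: U is open in |K| iff its trace on every closed
    simplex |sigma| (sigma a face) is open for the Euclidean topology of
    |sigma| (here expressed with the sup-distance of coordinates). *)
Definition cw_open (K : complex) (U : set (R -> R)) : Prop :=
  U `<=` realization K /\
  forall sigma, K sigma -> forall x, U x -> supp x `<=` sigma ->
    exists2 e : R, 0 < e & forall y, realization K y -> supp y `<=` sigma ->
      (forall v, `|x v - y v| < e) -> U y.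

Definition cw_continuous (K L : complex) (f : (R -> R) -> (R -> R)) : Prop :=
  (forall x, realization K x -> realization L (f x)) /\
  forall V, cw_open L V -> cw_open K [set x | realization K x /\ V (f x)].

(** homotopy between f, g : |K| -> |L|: a map H : |K| x [0,1] -> |L|,
    continuous for the product topology, with H(-,0) = f and H(-,1) = g. *)
Definition cw_homotopic (K L : complex) (f g : (R -> R) -> (R -> R)) : Prop :=
  exists H : (R -> R) -> R -> (R -> R),
  [/\ forall x, realization K x -> H x 0 = f x,
      forall x, realization K x -> H x 1 = g x,
      forall x t, realization K x -> 0 <= t <= 1 -> realization L (H x t) &
      forall V, cw_open L V -> forall x t, realization K x -> 0 <= t <= 1 ->
        V (H x t) ->
        exists U, [/\ cw_open K U, U x &
          (exists2 d : R, 0 < d & forall y s, U y -> 0 <= s <= 1 ->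
             `|s - t| < d -> V (H y s))]].

Definition cw_homotopy_equivalence (K L : complex) (f : (R -> R) -> (R -> R))
  : Prop :=
  cw_continuous K L f /\
  exists g, [/\ cw_continuous L K g,
               cw_homotopic K K (g \o f) id &
               cw_homotopic L L (f \o g) id].

Definition realize_map (phi : R -> R) (f : R -> R) : R -> R :=
  fun w => \sum_(v \in [set v | phi v = w]) f v.

End Defs.

(* Main.v *)
Require Import Defs.
From HB Require Import structures.
From mathcomp Require Import all_boot all_order all_algebra finmap.
From mathcomp Require Import lra.
From mathcomp Require Import boolp classical_sets functions cardinality fsbigop reals.
From mathcomp Require Import topology normedtype.
Import Order.TTheory GRing.Theory Num.Theory.
Import numFieldNormedType.Exports.
Local Open Scope classical_set_scope.
Local Open Scope ring_scope.

(** Stretch the circle carrying [T_r X] to circumference [1 + 2r]. There [pi_r]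
    is reduction modulo 1, and two vertices are adjacent when their coordinates
    in [0, 1 + 2r) differ by at most [2r] or at least [1]. For every face [B] of
    the Cech complex the full subcomplex of the Vietoris-Rips complex lying over
    [B] is a cone, with an apex [c B].

    A simplicial map [phi : K -> L] all of whose fibres over faces are cones is
    a homotopy equivalence. For [y] in [|L|] the superlevel sets [{y > s}] form a
    chain of faces, and their apexes span a face of [K]; the average over [s] of
    the apexes [c {y > s}] is a map [|L| -> |K|] whose composition with [phi]
    moves points only within their closed simplex. On [|K|], keeping the part
    [(h - t)^+] of [h] and replacing the levels [s < t] of its image by the
    apexes [c {phi h > s}] gives, after normalization, a homotopy from the
    identity at [t = 0] to the other composition at [t = 1]. *)

(** * Finite sets and finitely supported sums *)

Section FiniteSets.
Context {R : realType}.

Lemma finite_lower_bound (T : choiceType) (A : set T) (f : T -> R) :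
  finite_set A -> (forall a, A a -> 0 < f a) ->
  exists2 e : R, 0 < e & forall a, A a -> e <= f a.
Proof.
move=> /finite_seqP[s ->] {A}; elim: s => [|a s IH] fs; first by exists 1.
have [|e e0 es] := IH; first by move=> b /= bs; apply: fs; rewrite /= in_cons bs orbT.
exists (Num.min e (f a)).
  by rewrite lt_min e0 fs //= mem_head.
by move=> b /=; rewrite in_cons ge_min => /predU1P[->|/es->//]; rewrite lexx orbT.
Qed.


Lemma finite_argmin {T : choiceType} (A : set T) (f : T -> R) : finite_set A -> A !=set0 ->
  exists2 a, A a & forall b, A b -> f a <= f b.
Proof.
move=> /finite_seqP[s ->] {A} [a]; elim: s a => // a s IH _ _.
have [->|] := eqVneq s [::].
  by exists a => [|b]; rewrite /= mem_seq1 // => /eqP->.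
case: s IH => // a' s IH _; have [b bs bm] := IH a' (mem_head _ _).
have [ab|ba] := leP (f a) (f b).
  exists a => [|d]; rewrite /= in_cons ?eqxx // => /predU1P[->//|/bm].
  exact: le_trans.
exists b => [|d]; rewrite /= in_cons ?(orbC (b == a)) ?bs //.
by move=> /predU1P[->|/bm//]; exact: ltW.
Qed.

Lemma finite_powerset (W : set R) :
  finite_set W -> finite_set [set A : set R | A `<=` W].
Proof.
move=> /finite_fsetP[X ->].
apply: (@sub_finite_set _ _ ((fun A : {fset R} => [set` A]) @` [set` fpowerset X])).
  move=> A AX; have Af : finite_set A by exact: sub_finite_set AX _.
  exists (fset_set A); last by rewrite fset_setK.
  by rewrite /= fpowersetE; apply/fsubsetP => a; rewrite in_fset_set // inE => /AX.
exact: finite_image.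
Qed.

Lemma finite_chain_max (s : seq (set R)) : s != [::] ->
  (forall A B, A \in s -> B \in s -> A `<=` B \/ B `<=` A) ->
  exists2 A, A \in s & forall B, B \in s -> B `<=` A.
Proof.
elim: s => [//|A s IH] _ ch.
have [->|s0] := eqVneq s [::].
  by exists A => [|B]; rewrite mem_seq1 // => /eqP->.
have [B C|B Bs Bm] := IH s0.
  by move=> Bs Cs; apply: ch; rewrite in_cons ?Bs ?Cs orbT.
have BAs : B \in A :: s by rewrite in_cons Bs orbT.
have [AB|BA] := ch A B (mem_head _ _) BAs.
  exists B => [|C]; rewrite in_cons ?Bs ?orbT // => /predU1P[->//|]; exact: Bm.
exists A => [|C]; rewrite in_cons ?eqxx // => /predU1P[->//|/Bm CB].
exact: subset_trans BA.
Qed.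

Lemma near_finite {I : Type} {T : choiceType} (F : set_system I) (W : set T)
  (P : I -> T -> Prop) : Filter F -> finite_set W ->
  (forall v, W v -> \forall p \near F, P p v) ->
  \forall p \near F, forall v, W v -> P p v.
Proof.
move=> FF /finite_fsetP[X ->] h.
have := @filter_bigI _ _ X (fun v p => P p v) F FF (fun v vX => h v vX).
by apply: filterS => p hp v; exact: hp.
Qed.

Lemma sum_supportE (W : set R) (f : R -> R) : finite_set W ->
  supp f `<=` W -> \sum_(v \in [set: R]) f v = \sum_(v <- fset_set W) f v.
Proof.
move=> Wf fW; apply: fsbigTE => v; apply: contraNeq => fv.
by rewrite in_fset_set // inE; exact: fW.
Qed.

Lemma sum_support_gt0 (f : R -> R) : finite_set (supp f) -> (forall v, 0 <= f v) ->
  supp f !=set0 -> 0 < \sum_(v \in [set: R]) f v.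
Proof.
move=> ff f0 [v fv]; rewrite (sum_supportE (supp f)) //.
rewrite (big_rem v) /=; last by rewrite in_fset_set // inE.
by rewrite ltr_pwDl ?sumr_ge0 // lt_neqAle eq_sym fv f0.
Qed.

End FiniteSets.

(** * Maps and homotopies that are continuous on every closed simplex *)

Section Cells.
Context {R : realType}.
Implicit Types (K L : complex R) (s t : R).

Definition is_complex K :=
  (forall A, K A -> finite_set A) /\
  (forall A B, K A -> B `<=` A -> B !=set0 -> K B).

Lemma realization_le1 K (x : R -> R) v : is_complex K -> realization K x -> x v <= 1.
Proof.
move=> [Kf _] [/Kf xf x0 <-]; rewrite (sum_supportE (supp x)) //.
have [->|xv] := eqVneq (x v) 0; first exact: sumr_ge0.
rewrite (big_rem v) /=; last by rewrite in_fset_set // inE.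
by rewrite lerDl sumr_ge0.
Qed.

Definition unit_interval : set R := [set t | 0 <= t <= 1].

(* Neighbourhoods of [x] within the closed simplex spanned by [A]. *)
Definition simplex_nbhs K (A : set R) (x : R -> R) : set_system (R -> R) :=
  [set P | exists2 e : R, 0 < e & forall y, realization K y -> supp y `<=` A ->
     (forall v, `|x v - y v| < e) -> P y].

Global Instance simplex_nbhs_filter K A x : Filter (simplex_nbhs K A x).
Proof.
split; first by exists 1.
- move=> P Q [e e0 eP] [d d0 dQ]; exists (Num.min e d); first by rewrite lt_min e0.
  move=> y Ky yA xy; split; [apply: eP|apply: dQ] => // v;
    by have := xy v; rewrite lt_min => /andP[].
- by move=> P Q PQ [e e0 eP]; exists e => // y Ky yA xy; apply: PQ; exact: eP.
Qed.

Definition cell_nbhs K A x t : set_system ((R -> R) * R) :=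
  filter_prod (simplex_nbhs K A x) (within unit_interval (nbhs t)).

Lemma simplex_nbhsT K A x :
  \forall y \near simplex_nbhs K A x, realization K y /\ supp y `<=` A.
Proof. by exists 1. Qed.

Lemma cell_nbhsT K A x t : \forall p \near cell_nbhs K A x t,
  [/\ realization K p.1, supp p.1 `<=` A & 0 <= p.2 <= 1].
Proof.
exists ([set y | realization K y /\ supp y `<=` A], unit_interval) => /=.
  split; first exact: simplex_nbhsT.
  exact: withinT.
by move=> [y s] [[]].
Qed.

Lemma cvg_cell_snd K A x t : p.2 @[p --> cell_nbhs K A x t] --> t.
Proof. by apply: cvg_trans; [exact: cvg_snd|exact: cvg_within]. Qed.

(** Convergence in the sup-distance of coordinates, by which [cw_open] measures neighbourhoods. *)
Definition ucvg {I : Type} (F : set_system I) (Y : I -> R -> R) (y : R -> R) :=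
  forall e, 0 < e -> \forall p \near F, forall v, `|y v - Y p v| < e.

Lemma ucvg_cell_fst K A x t : ucvg (cell_nbhs K A x t) fst x.
Proof.
move=> e e0; exists ([set y | forall v, `|x v - y v| < e], setT) => /=.
  by split; [exists e|exact: filterT].
by move=> [y s] [].
Qed.

Lemma ucvg_cvg {I : Type} (F : set_system I) (Y : I -> R -> R) y v : Filter F ->
  ucvg F Y y -> Y p v @[p --> F] --> y v.
Proof.
move=> FF h; apply/cvgrPdist_lt => e /h; apply: filterS => p; exact.
Qed.

(** Outside [W] both sides vanish, which leaves finitely many coordinates to control. *)
Lemma ucvg_finite {I : Type} (F : set_system I) (Y : I -> R -> R) y (W : set R) :
  Filter F -> finite_set W -> supp y `<=` W ->
  (\forall p \near F, supp (Y p) `<=` W) ->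
  (forall v, W v -> Y p v @[p --> F] --> y v) -> ucvg F Y y.
Proof.
move=> FF Wf yW YW cY e e0.
have : \forall p \near F, forall v, W v -> `|y v - Y p v| < e.
  by apply: near_finite => // v /cY/cvgrPdist_lt; exact.
apply: filterS2 YW => p YpW h v; have [/h//|nW] := pselect (W v).
have z0 (z : R -> R) : supp z `<=` W -> z v = 0.
  by move=> zW; apply/eqP; apply: contrapT => /negP /zW.
by rewrite !z0 // subrr normr0.
Qed.

(** Finitely many faces have all vertices in [W], so their radii have a positive minimum. A point
    closer to [z] than the least positive coordinate of [z] has a support containing [supp z], so
    openness applies on the simplex spanned by its own support. *)
Lemma cw_open_finite L V z (W : set R) : is_complex L -> cw_open L V -> V z ->
  finite_set W ->
  exists2 e : R, 0 < e & forall y, realization L y -> supp y `<=` W ->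
    (forall v, `|z v - y v| < e) -> V y.
Proof.
move=> [Lf Ls] [VL Vo] Vz Wf.
have [Lz z0 _] := VL _ Vz.
have [d d0 dz] : exists2 d : R, 0 < d & forall v, supp z v -> d <= z v.
  apply: finite_lower_bound; first exact: Lf.
  by move=> v zv; rewrite lt_neqAle eq_sym zv z0.
have h (B : set R) : exists e : R, 0 < e /\ (L B -> supp z `<=` B ->
   forall y, realization L y -> supp y `<=` B -> (forall v, `|z v - y v| < e) -> V y).
  have [LB|] := pselect (L B); last by exists 1.
  have [zB|] := pselect (supp z `<=` B); last by exists 1.
  by have [e e0 he] := Vo B LB z Vz zB; exists e.
have [E hE] := choice h.
have [e e0 eE] : exists2 e : R, 0 < e & forall B, B `<=` W -> e <= E B.
  apply: finite_lower_bound; first exact: finite_powerset.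
  by move=> B _; case: (hE B).
exists (Num.min d e); first by rewrite lt_min d0.
move=> y Ly yW zy.
have [_ /(_ _ _ _)] := hE (supp y); apply => //; first by case: Ly.
  move=> v zv; apply/negP => /eqP yv; have := zy v.
  by rewrite yv subr0 ger0_norm // lt_min => /andP[+ _]; rewrite ltNge dz.
by move=> v; have := zy v; rewrite lt_min => /andP[_ /lt_le_trans]; apply; exact: eE.
Qed.

(** The set [W] is finite but may fail to be a face of [L]. By [cw_open_finite] a weakly open set
    contains small sup-balls among the points supported in [W], so convergence of each coordinate is
    enough. *)
Definition cell_continuous K L (F : (R -> R) -> R -> (R -> R)) :=
  (forall x t, realization K x -> 0 <= t <= 1 -> realization L (F x t)) /\
  forall A, K A -> exists2 W : set R, finite_set W &
    forall x t, realization K x -> supp x `<=` A -> 0 <= t <= 1 ->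
      supp (F x t) `<=` W /\
      forall v, F p.1 p.2 v @[p --> cell_nbhs K A x t] --> F x t v.

Lemma cell_continuous_open K L F V A x t : is_complex L -> cell_continuous K L F ->
  cw_open L V -> K A -> realization K x -> supp x `<=` A -> 0 <= t <= 1 ->
  V (F x t) -> \forall p \near cell_nbhs K A x t, V (F p.1 p.2).
Proof.
move=> Lc [FL Fc] Vo KA Kx xA t01 VF.
have [W Wf hW] := Fc A KA.
have [e e0 eV] := cw_open_finite _ _ _ _ Lc Vo VF Wf.
have [FW Fv] := hW x t Kx xA t01.
have cT := cell_nbhsT K A x t.
have : ucvg (cell_nbhs K A x t) (fun p => F p.1 p.2) (F x t).
  apply: (ucvg_finite _ _ _ W) => //.
  by apply: filterS cT => p [? ? ?]; case: (hW p.1 p.2).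
move=> /(_ e e0); apply: filterS2 cT => p [? ? ?] ?.
by apply: eV => //; [exact: FL|case: (hW p.1 p.2)].
Qed.

(* The tube lemma for the compact interval [I] makes the set of [y] with
   [F y s] in [V] for all [s] in [I] cw-open. *)
Lemma cell_continuous_homotopic K L F f g : is_complex L ->
  cell_continuous K L F -> (forall x, realization K x -> F x 0 = f x) ->
  (forall x, realization K x -> F x 1 = g x) -> cw_homotopic K L f g.
Proof.
move=> Lc FC F0 F1; exists F; split=> // [|V Vo x t Kx t01 VF]; first by case: FC.
have := cell_continuous_open _ _ _ _ (supp x) _ _ Lc FC Vo _ Kx (@subset_refl _ _) t01 VF.
move=> []; first by case: Kx.
move=> [P Q] /= [Px]; rewrite /within /= => Qt PQ.
have VQ s : Q s -> V (F x s).
  move=> Qs; apply: (PQ (x, s)); split => //=; case: Px => e e0; apply => // v.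
  by rewrite subrr normr0.
have /nbhs_ballP[d /= d0 dQ] := Qt.
(* The half-width [d / 2] keeps this compact interval inside the ball of radius [d] about [t], and
   every time in [[0, 1]] closer to [t] than [d / 2] belongs to it. *)
pose I := `[Num.max 0 (t - d / 2), Num.min 1 (t + d / 2)]%classic.
have I01 s : I s -> 0 <= s <= 1.
  by rewrite /I /= in_itv /= ge_max le_min => /andP[/andP[-> _] /andP[-> _]].
exists [set y | realization K y /\ forall s, I s -> V (F y s)]; split.
- split; first by move=> y [].
  move=> A KA y [Ky yV] yA.
  have cI : compact I by exact: segment_compact.
  have /compact_near_coveringP/near_covering_withinP := cI.
  move=> /(_ _ (simplex_nbhs K A y) (fun z s => V (F z s)) _)[].
    move=> s Is; have := cell_continuous_open _ _ _ _ A _ _ Lc FC Vo KA Ky yA (I01 s Is) (yV s Is).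
    move=> [[P' Q'] /= [P'y Q's]] PQ'.
    exists ([set s | unit_interval s -> Q' s], P') => //=.
    move=> [s' z] /= [Q's' P'z] /I01 Is'.
    by apply: (PQ' (z, s')); split => //=; exact: Q's'.
  move=> e e0 eP; exists e => // z Kz zA yz; split => //; exact: eP.
- split => // s Is; apply: VQ; apply: dQ; last exact: I01.
  move: Is; rewrite /I /= in_itv /= ge_max le_min => /andP[/andP[_ ?] /andP[_ ?]].
  by rewrite /ball /= ltr_norml; apply/andP; split; lra.
- exists (d / 2); first by rewrite divr_gt0.
  move=> y s [Ky yV] /andP[s0 s1]; rewrite ltr_norml => /andP[? ?]; apply: yV.
  by rewrite /I /= in_itv /= ge_max le_min s0 s1 /=; apply/andP; split; lra.
Qed.

Lemma cell_continuous_cw K L F t : is_complex L -> 0 <= t <= 1 ->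
  cell_continuous K L F -> cw_continuous K L (F ^~ t).
Proof.
move=> Lc t01 FC; split => [x Kx|V Vo]; first by case: FC => + _; exact.
split => [x []//|A KA x [Kx VF] xA].
have [[P Q] /= [[e e0 eP] Qt] PQ] :=
  cell_continuous_open _ _ _ _ A _ _ Lc FC Vo KA Kx xA t01 VF.
exists e => // y Ky yA xy; split => //; apply: (PQ (y, t)); split => /=; first exact: eP.
exact: nbhs_singleton Qt t01.
Qed.

Lemma cvg_sum_seq {I : Type} {T : eqType} (F : set_system I) (r : seq T)
  (f : I -> T -> R) (g : T -> R) : Filter F ->
  (forall i, i \in r -> f p i @[p --> F] --> g i) ->
  \sum_(i <- r) f p i @[p --> F] --> \sum_(i <- r) g i.
Proof.
move=> FF; elim: r => [|i r IH] h.
  by rewrite big_nil; under eq_cvg do rewrite big_nil; exact: cvg_cst.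
rewrite big_cons; under eq_cvg do rewrite big_cons.
apply: cvgD; first by apply: h; exact: mem_head.
by apply: IH => j jr; apply: h; rewrite in_cons jr orbT.
Qed.

End Cells.

(** * Superlevel sets of barycentric coordinates *)

Section Levels.
Context {R : realType}.
Implicit Types (A W : set R) (x y : R -> R) (s t : R).

Definition unit_valued y := forall v, 0 <= y v <= 1.

(** The superlevel set at [s >= 0] is [A] when [s] is below all values on [A] and at least all
    values off [A]. A gap is thus a right end minus a left end; a [b] in [A] supplies the left end
    0. *)
Definition level_gaps A y t : set R :=
  [set z | exists2 a, A a & exists b,
     z = Num.min t (y a) - (if b \in A then 0 else y b)].

(* For finitely supported [y >= 0], the length of the set of all
   [0 <= s < t] with [A = {v | y v > s}]. *)
Definition level A y t : R := Num.max 0 (inf (level_gaps A y t)).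

Lemma level_ge0 A y t : 0 <= level A y t.
Proof. by rewrite le_max lexx. Qed.

Lemma level_gaps_has_inf A y t : A !=set0 -> unit_valued y -> 0 <= t ->
  has_inf (level_gaps A y t).
Proof.
move=> [a Aa] y01 t0; split.
  by exists (Num.min t (y a) - (if a \in A then 0 else y a)); exists a => //; exists a.
exists (-1) => z [a' _ [b ->]].
have /andP[yb0 yb1] := y01 b; have /andP[ya0 ya1] := y01 a'.
have : 0 <= Num.min t (y a') by rewrite le_min t0.
by case: ifP => _; lra.
Qed.

(** A positive infimum makes every gap positive. The choice [b = a] gives [0 < y a]; a [b] outside
    [A] separates the values off [A] from those on [A]. *)
Lemma level_gt0P A y t a b : A !=set0 -> unit_valued y -> 0 <= t ->
  0 < level A y t -> A a -> (if b \in A then 0 else y b) < Num.min t (y a).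
Proof.
move=> A0 y01 t0; rewrite /level lt_max ltxx /= => h Aa.
rewrite -subr_gt0; apply: lt_le_trans h _.
apply: ge_inf; last by exists a => //; exists b.
by case: (level_gaps_has_inf _ _ _ A0 y01 t0).
Qed.

Lemma level_gt0_supp A y t : A !=set0 -> unit_valued y -> 0 <= t ->
  0 < level A y t -> A `<=` supp y.
Proof.
move=> A0 y01 t0 h a Aa; have := level_gt0P _ _ _ a a A0 y01 t0 h Aa.
by rewrite mem_set // lt_min => /andP[_ /lt0r_neq0].
Qed.

Lemma level_gt0_lt A y t a b : A !=set0 -> unit_valued y -> 0 <= t ->
  0 < level A y t -> A a -> ~ A b -> y b < Num.min t (y a).
Proof.
move=> A0 y01 t0 h Aa Ab; have := level_gt0P _ _ _ a b A0 y01 t0 h Aa.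
by rewrite memNset.
Qed.

(** Given a point of [A] outside [B] and a point of [B] outside [A], each would have a coordinate
    strictly larger than the other. *)
Lemma level_chain A B y t : A !=set0 -> B !=set0 -> unit_valued y -> 0 <= t ->
  0 < level A y t -> 0 < level B y t -> A `<=` B \/ B `<=` A.
Proof.
move=> A0 B0 y01 t0 hA hB; apply: contrapT => /not_orP[].
move=> /existsNP[a /not_implyP[Aa Ba]] /existsNP[b /not_implyP[Bb Ab]].
have := level_gt0_lt _ _ _ _ _ A0 y01 t0 hA Aa Ab.
have := level_gt0_lt _ _ _ _ _ B0 y01 t0 hB Bb Ba.
rewrite !lt_min => /andP[_ h1] /andP[_ h2].
by have := lt_trans h1 h2; rewrite ltxx.
Qed.

Lemma level_supp_gt0 y t : finite_set (supp y) -> supp y !=set0 ->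
  unit_valued y -> 0 < t -> 0 < level (supp y) y t.
Proof.
move=> yf y0 y01 t0.
have [e e0 ey] : exists2 e, 0 < e & forall a, supp y a -> e <= y a.
  apply: finite_lower_bound => // a ya.
  by rewrite lt_neqAle eq_sym ya; case/andP: (y01 a).
rewrite /level lt_max; apply/orP; right.
(* Below the least positive coordinate the superlevel set is the whole support. *)
apply: (@lt_le_trans _ _ (Num.min t e)); first by rewrite lt_min t0.
apply: lb_le_inf.
  by case: (level_gaps_has_inf _ _ _ y0 y01 (ltW t0)).
move=> z [a ya [b ->]].
have -> : (if b \in supp y then 0 else y b) = 0.
  case: ifPn => // /negP yb; apply/eqP; apply: contra_notT yb => yb.
  by rewrite inE.
by rewrite subr0 le_min !ge_min lexx (ey a ya) orbT.
Qed.

(** Both ends of a gap move by at most [d], so the infimum drops by at most [d + d]. *)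
Lemma inf_gaps_le A x y s t d : A !=set0 -> unit_valued x -> unit_valued y ->
  0 <= s -> 0 <= t -> (forall v, `|x v - y v| < d) -> `|s - t| < d ->
  inf (level_gaps A x s) - (d + d) <= inf (level_gaps A y t).
Proof.
move=> A0 x01 y01 s0 t0 xy st; apply: lb_le_inf.
  by case: (level_gaps_has_inf _ _ _ A0 y01 t0).
move=> z [a Aa [b ->]].
have : inf (level_gaps A x s) <= Num.min s (x a) - (if b \in A then 0 else x b).
  apply: ge_inf; last by exists a => //; exists b.
  by case: (level_gaps_has_inf _ _ _ A0 x01 s0).
have := xy a; have := xy b; move: st; rewrite !ltr_norml.
move=> /andP[? ?] /andP[? ?] /andP[? ?] h.
have : Num.min s (x a) - d <= Num.min t (y a).
  rewrite le_min; have := ge_min s s (x a); have := ge_min (x a) s (x a).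
  by rewrite !lexx orbT /= => ? ?; apply/andP; split; lra.
by move: h; case: ifP => _; lra.
Qed.

Lemma cvg_level {I : Type} (F : set_system I) (Y : I -> R -> R) (S : I -> R) A y t :
  Filter F -> A !=set0 -> unit_valued y -> 0 <= t ->
  (\forall p \near F, unit_valued (Y p) /\ 0 <= S p) ->
  ucvg F Y y -> S @ F --> t -> level A (Y p) (S p) @[p --> F] --> level A y t.
Proof.
move=> FF A0 y01 t0 YS Yy St; apply/cvgrPdist_le => e e0.
have e2 : 0 < e / 2 by rewrite divr_gt0.
have /cvgrPdist_lt/(_ _ e2) S2 := St.
apply: filterS3 YS (Yy _ e2) S2 => p [Y01 S0] h1 h2.
have := inf_gaps_le A _ _ _ _ _ A0 y01 Y01 t0 S0 h1 h2.
have h3 v : `|Y p v - y v| < e / 2 by rewrite distrC.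
have h4 : `|S p - t| < e / 2 by rewrite distrC.
have := inf_gaps_le A _ _ _ _ _ A0 Y01 y01 S0 t0 h3 h4.
rewrite -splitr /level ler_norml => i1 i2.
move: i1 i2; set i := inf _; set j := inf _ => ? ?.
by case: (lerP 0 i) => ?; case: (lerP 0 j) => ?; apply/andP; split; lra.
Qed.

End Levels.

(** * The map of realizations induced by a simplicial map *)

Section RealizeMap.
Context {R : realType} (K L : complex R) (phi : R -> R).
Hypotheses (Kc : is_complex K) (phiS : simplicial K L phi).

Lemma realize_mapE (A : set R) (x : R -> R) w : finite_set A -> supp x `<=` A ->
  realize_map phi x w = \sum_(v <- fset_set A | phi v == w) x v.
Proof.
move=> Af xA; rewrite /realize_map fsbig_mkcond (fsbigTE (fset_set A)).
  rewrite [RHS]big_mkcond; apply: eq_bigr => v _; rewrite /patch.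
  by case: ifPn; [rewrite inE => /= /eqP->|rewrite notin_setE => /= /eqP/negbTE->].
move=> v; rewrite in_fset_set // notin_setE => vA; rewrite /patch; case: ifP => // _.
by apply/eqP; apply: contra_notT vA; exact: xA.
Qed.

Lemma realize_map_supp (x : R -> R) : supp (realize_map phi x) `<=` phi @` supp x.
Proof.
move=> w h.
by have [v pv xv] := @fsbigN1 R 0 +%R R R [set v | phi v = w] (fun=> x) w h; exists v.
Qed.

(** No summand exceeds a sum of nonnegative terms. This supplies the bound [h v <= y (phi v)]
    required by [blend_face]. *)
Lemma realize_map_ge (x : R -> R) v : finite_set (supp x) -> (forall v, 0 <= x v) ->
  x v <= realize_map phi x (phi v).
Proof.
move=> xf x0; rewrite (realize_mapE (supp x)) //.
have [->|xv] := eqVneq (x v) 0; first exact: sumr_ge0.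
rewrite (big_rem v) /= ?eqxx; last by rewrite in_fset_set // inE.
by rewrite lerDl sumr_ge0.
Qed.

Lemma realize_map_realization (x : R -> R) :
  realization K x -> realization L (realize_map phi x).
Proof.
move=> [Kx x0 x1]; have xf := Kc.1 _ Kx.
have -> : realization L (realize_map phi x) =
  [/\ L (phi @` supp x), forall v, 0 <= realize_map phi x v &
    \sum_(v \in [set: R]) realize_map phi x v = 1].
  (* Nonnegative coordinates cannot cancel, so the support of the image is the whole image of the
     support. *)
  rewrite /realization /=; suff -> : supp (realize_map phi x) = phi @` supp x by [].
  apply/seteqP; split; first exact: realize_map_supp.
  move=> _ [v xv <-]; apply: lt0r_neq0; apply: lt_le_trans (realize_map_ge _ v xf x0).
  by rewrite lt_neqAle eq_sym xv x0.
split; first exact: phiS.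
  by move=> w; exact: fsumr_ge0.
rewrite (sum_supportE (phi @` supp x)); last exact: realize_map_supp.
  rewrite -[RHS]x1 [RHS](sum_supportE (supp x)) //.
  under eq_bigr do rewrite (realize_mapE (supp x)) // big_mkcond /=.
  rewrite exchange_big /= big_seq [RHS]big_seq; apply: eq_bigr => v vx.
  rewrite (bigD1_seq (phi v)) ?fset_uniq //=.
    by rewrite eqxx big1 ?addr0 // => w; rewrite eq_sym => /negbTE->.
  rewrite in_fset_set ?inE; last exact: finite_image.
  by exists v => //; move: vx; rewrite in_fset_set // inE.
exact: finite_image.
Qed.

Lemma cvg_realize_map {I : Type} (F : set_system I) (Y : I -> R -> R) y (A : set R) w :
  Filter F -> finite_set A -> supp y `<=` A -> (\forall p \near F, supp (Y p) `<=` A) ->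
  (forall v, Y p v @[p --> F] --> y v) ->
  realize_map phi (Y p) w @[p --> F] --> realize_map phi y w.
Proof.
move=> FF Af yA YA Yy; rewrite (realize_mapE A) // big_mkcond /=.
apply: (@cvg_trans _ ((fun p => \sum_(v <- fset_set A)
    if phi v == w then Y p v else 0) @ F)).
  apply: near_eq_cvg; apply: filterS YA => p pA.
  by rewrite (realize_mapE A) // [RHS]big_mkcond.
by apply: cvg_sum_seq => v _; case: ifP => _; [exact: Yy|exact: cvg_cst].
Qed.

Lemma cell_continuous_realize_map :
  cell_continuous K L (fun x _ => realize_map phi x).
Proof.
split=> [x t Kx _|A KA]; first exact: realize_map_realization.
have Af := Kc.1 _ KA.
exists (phi @` A) => [|x t Kx xA t01]; first exact: finite_image.
split=> [|v].
  by move=> w /realize_map_supp[u /xA Au <-]; exists u.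
apply: (cvg_realize_map _ _ _ A) => //.
  by apply: filterS (cell_nbhsT K A x t) => p [].
by move=> u; apply: ucvg_cvg; exact: ucvg_cell_fst.
Qed.

End RealizeMap.

(** * Rescaling to total weight 1, and segments inside a closed simplex *)

Section Normalize.
Context {R : realType} (K : complex R).
Hypothesis Kc : is_complex K.

Definition normalize (f : R -> R) : R -> R :=
  fun v => f v / \sum_(w \in [set: R]) f w.

Lemma normalize_realization (f : R -> R) :
  K (supp f) -> (forall v, 0 <= f v) -> supp f !=set0 -> realization K (normalize f).
Proof.
move=> Kf f0 fn; have ff := Kc.1 _ Kf; have s0 := sum_support_gt0 f ff f0 fn.
have nE : supp (normalize f) = supp f.
  apply/seteqP; split => v; rewrite /supp /normalize /= mulf_eq0 invr_eq0 negb_or.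
    by case/andP.
  by move=> ->; rewrite gt_eqF.
split; first by rewrite nE.
  by move=> v; rewrite divr_ge0 // ltW.
by rewrite -mulr_fsuml divff // gt_eqF.
Qed.

Lemma normalize_supp (f : R -> R) : supp (normalize f) `<=` supp f.
Proof. by move=> v; rewrite /supp /normalize /= mulf_eq0 negb_or => /andP[]. Qed.

Lemma normalize_id (x : R -> R) : realization K x -> normalize x = x.
Proof. by move=> [_ _ x1]; apply/funext => v; rewrite /normalize x1 divr1. Qed.

Lemma cvg_normalize {I : Type} (F : set_system I) (Y : I -> R -> R) y (W : set R) v :
  Filter F -> finite_set W -> supp y `<=` W ->
  (\forall p \near F, supp (Y p) `<=` W) ->
  (forall v, Y p v @[p --> F] --> y v) -> \sum_(w \in [set: R]) y w != 0 ->
  normalize (Y p) v @[p --> F] --> normalize y v.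
Proof.
move=> FF Wf yW YW Yy y0; apply: cvgM; first exact: Yy.
apply: cvgV => //; rewrite (sum_supportE W) //.
apply: (@cvg_trans _ ((fun p => \sum_(w <- fset_set W) Y p w) @ F)).
  by apply: near_eq_cvg; apply: filterS YW => p pW; rewrite (sum_supportE W).
by apply: cvg_sum_seq.
Qed.

Lemma segment_realization (x y : R -> R) t : realization K x -> realization K y ->
  supp x `<=` supp y -> 0 <= t <= 1 ->
  realization K (fun v => (1 - t) * x v + t * y v).
Proof.
move=> [Kx x0 x1] [Ky y0 y1] xy /andP[t0 t1]; have yf := Kc.1 _ Ky.
set z := fun v => _.
have zy : supp z `<=` supp y.
  move=> v; rewrite /supp /z /= => zv; apply/eqP => yv; move: zv.
  have -> : x v = 0 by apply: contrapT => /eqP /xy; rewrite /supp /= yv eqxx.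
  by rewrite yv !mulr0 addr0 eqxx.
have z1 : \sum_(v \in [set: R]) z v = 1.
  rewrite (sum_supportE (supp y)) // big_split /= -!mulr_sumr.
  rewrite -!(sum_supportE (supp y)) // x1 y1; lra.
split => //.
  apply: (Kc.2 (supp y)) => //; apply/set0P/eqP => z0.
  suff : \sum_(v \in [set: R]) z v = 0 by rewrite z1 => /eqP; rewrite oner_eq0.
  apply: fsbig1 => v _; apply: contrapT => /eqP zv.
  by have : supp z v by []; rewrite z0.
by move=> v; rewrite addr_ge0 // mulr_ge0 // subr_ge0.
Qed.

End Normalize.

(** * Simplicial maps whose fibres over faces are cones *)

Section Fibre.
Context {R : realType} (K L : complex R) (phi : R -> R) (c : set R -> R).
Hypotheses (Kc : is_complex K) (Lc : is_complex L) (phiS : simplicial K L phi).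
Hypothesis apex_over : forall B, L B -> B (phi (c B)).
(** The case [A = set0] makes the apex itself a vertex of [K]. *)
Hypothesis apex_cone : forall A B, L B -> A = set0 \/ K A -> phi @` A `<=` B ->
  K (A `|` [set c B]).

Let L_neq0 B : L B -> B !=set0.
Proof. by move=> /apex_over ?; exists (phi (c B)). Qed.

Let realization_unit_valued y : realization L y -> unit_valued y.
Proof. by move=> Ly v; rewrite (realization_le1 L) // andbT; case: Ly. Qed.

(** Induction on the chain: remove its largest member [M]. The set [A] and the apexes of the smaller
    members all lie over [M], so the cone with apex [c M] adds the last vertex. *)
Lemma cone_chain (s : seq (set R)) (A : set R) : A = set0 \/ K A ->
  (forall B, B \in s -> L B /\ phi @` A `<=` B) ->
  (forall B C, B \in s -> C \in s -> B `<=` C \/ C `<=` B) ->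
  let U := A `|` [set c B | B in [set` s]] in U = set0 \/ K U.
Proof.
have [n] := ubnP (size s); elim: n s => // n IH s; rewrite ltnS => sn KA sL sch U.
have [s0|s0] := eqVneq s [::].
  suff -> : U = A by [].
  by rewrite /U s0; apply/seteqP; split => [v [//|[]]//|v]; left.
have [M Ms Mmax] := finite_chain_max s s0 sch; have [LM AM] := sL M Ms.
pose s' := rem M s.
have ss B : B \in s' -> B \in s by exact: mem_rem.
have : let U' := A `|` [set c B | B in [set` s']] in U' = set0 \/ K U'.
  apply: IH => //.
  - rewrite size_rem //; apply: leq_trans sn.
    by case: (s) s0 => //= ? ?; rewrite ltnSn.
  - by move=> B /ss /sL.
  - by move=> B C /ss Bs /ss Cs; exact: sch.
move=> /(apex_cone _ _ LM) h; right.
have -> : U = (A `|` [set c B | B in [set` s']]) `|` [set c M].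
  apply/seteqP; split => [v [Av|[B /= Bs <-]]|v [[Av|[B /= Bs <-]]|->]].
  - by left; left.
  - have [->|BM] := eqVneq B M; first by right.
    left; right; exists B => //=; move: Bs.
    by rewrite (perm_mem (perm_to_rem Ms)) in_cons (negbTE BM).
  - by left.
  - by right; exists B => //=; exact: ss.
  - by right; exists M.
apply: h => _ [v [Av|[B /= /ss Bs <-]] <-]; first by apply: AM; exists v.
by apply: (Mmax B Bs); apply: apex_over; case: (sL B Bs).
Qed.

(* The levels of [y] below [t], concentrated at the corresponding apexes. *)
Definition lower (y : R -> R) (t : R) : R -> R :=
  fun v => \sum_(B \in [set B | L B /\ c B = v]) level B y t.

Definition blend (y h : R -> R) (t : R) : R -> R :=
  fun v => lower y t v + Num.max 0 (h v - t).

Lemma lower_ge0 y t v : 0 <= lower y t v.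
Proof. by apply: fsumr_ge0 => B _; exact: level_ge0. Qed.

Lemma blend_ge0 y h t v : 0 <= blend y h t v.
Proof. by rewrite addr_ge0 ?lower_ge0 // le_max lexx. Qed.

(** A positive level lies inside [supp y], hence inside [W]. The index set of the sum no longer
    depends on [y] or [t], so limits can be taken termwise. *)
Lemma lowerE (W : set R) y t v : finite_set W -> supp y `<=` W ->
  unit_valued y -> 0 <= t ->
  lower y t v =
  \sum_(B <- fset_set [set B | [/\ B `<=` W, L B & c B = v]]) level B y t.
Proof.
move=> Wf yW y01 t0; rewrite -fsbig_finite; last first.
  by apply: sub_finite_set (finite_powerset W Wf) => B [].
apply/esym/fsbig_widen => [B [? ? ?]//|B [[LB cB] nB]] /=; apply/eqP.
rewrite eq_le level_ge0 andbT leNgt; apply/negP => lB; apply: nB; split => //.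
by apply: subset_trans yW; apply: level_gt0_supp lB => //; exact: L_neq0.
Qed.

Lemma lower_neq0 y t v : lower y t v != 0 ->
  exists B, [/\ L B, c B = v & 0 < level B y t].
Proof.
move=> h.
have [B [LB cB] lB] := @fsbigN1 R 0 +%R R (set R)
  [set B | L B /\ c B = v] (fun _ B => level B y t) v h.
by exists B; split => //; rewrite lt_neqAle eq_sym lB level_ge0.
Qed.

Lemma lower_apex_gt0 y t B : finite_set (supp y) -> unit_valued y -> 0 <= t ->
  L B -> 0 < level B y t -> 0 < lower y t (c B).
Proof.
move=> yf y01 t0 LB lB; rewrite (lowerE (supp y)) //.
rewrite (big_rem B) /=.
  by rewrite ltr_pwDl // sumr_ge0 // => *; exact: level_ge0.
rewrite in_fset_set ?inE.
  by split => //; apply: level_gt0_supp lB => //; exact: L_neq0.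
by apply: sub_finite_set (finite_powerset (supp y) yf) => ? [].
Qed.

Lemma blend_supp y h t : unit_valued y -> 0 <= t -> (forall v, 0 <= h v) ->
  supp (blend y h t) `<=`
    supp h `|` [set c B | B in [set B | B `<=` supp y]].
Proof.
move=> y01 t0 h0 v; rewrite /supp /blend /=.
have [l0|/lower_neq0[B [LB <- lB]] _] := eqVneq (lower y t v) 0.
  rewrite l0 add0r => hv; left; apply: contra_neq hv => ->.
  by rewrite sub0r max_l // oppr_le0.
by right; exists B => //=; apply: level_gt0_supp lB => //; exact: L_neq0.
Qed.

(* The levels of [y] below [t] form a chain of faces, each containing the
   image of [{v | h v > t}]. *)
Lemma blend_face y h t : realization L y -> supp h = set0 \/ K (supp h) ->
  (forall v, 0 <= h v) -> (forall v, h v <= y (phi v)) -> 0 <= t ->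
  supp (blend y h t) !=set0 -> K (supp (blend y h t)).
Proof.
move=> Ly Kh h0 hy t0 bn.
have y01 := realization_unit_valued y Ly.
have yf : finite_set (supp y) by apply: Lc.1; case: Ly.
pose S := [set B | L B /\ 0 < level B y t].
have Sf : finite_set S.
  apply: sub_finite_set (finite_powerset _ yf) => B [LB lB].
  by apply: level_gt0_supp lB => //; exact: L_neq0.
pose A := [set v | t < h v].
have Ah : A `<=` supp h by move=> v /(le_lt_trans t0)/lt0r_neq0.
have KA : A = set0 \/ K A.
  have [->|/set0P A0] := eqVneq A set0; [by left|right].
  case: Kh => [h_0|Kh]; last exact: (Kc.2 _ _ Kh Ah A0).
  by case: A0 => v /Ah; rewrite h_0.
have memS B : (B \in fset_set S) = (B \in S) by rewrite in_fset_set.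
have /= := cone_chain (fset_set S) A KA.
have -> : A `|` [set c B | B in [set` fset_set S]] = supp (blend y h t).
  rewrite fset_setK //; apply/seteqP; split => v.
    move=> [Av|[B [LB lB] <-]]; rewrite /supp /blend /=; apply: lt0r_neq0.
      by rewrite ltr_wpDl ?lower_ge0 // lt_max subr_gt0 Av orbT.
    by rewrite ltr_pwDl ?lower_apex_gt0 // le_max lexx.
  rewrite /supp /blend /=.
  have [l0|/lower_neq0[B [LB <- lB]] _] := eqVneq (lower y t v) 0; last first.
    by right; exists B.
  rewrite l0 add0r => hv; left; rewrite /A /= ltNge; apply: contra_neqN hv => hv.
  by rewrite max_l // subr_le0.
case.
- move=> B; rewrite memS inE => -[LB lB]; split => // _ [v Av <-].
  apply: contrapT => nB; have [b Bb] := L_neq0 B LB.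
  (* If [phi v] were outside [B], then [y (phi v) < t < h v], against [h v <= y (phi v)]. *)
  have := level_gt0_lt _ _ _ _ _ (L_neq0 B LB) y01 t0 lB Bb nB.
  rewrite lt_min => /andP[yt _]; have := lt_trans yt Av.
  by rewrite ltNge hy.
- move=> B C; rewrite !memS !inE => -[LB lB] [LC lC].
  by apply: level_chain lB lC => //; exact: L_neq0.
- by move=> b0; case: bn => v; rewrite b0.
- by [].
Qed.

(** For [t > 0] the level of the full support is positive and gives weight to its apex; at [t = 0]
    only [h] can contribute. *)
Lemma blend_supp_neq0 y h t : realization L y -> 0 <= t ->
  (t = 0 -> exists v, 0 < h v) -> supp (blend y h t) !=set0.
Proof.
move=> Ly t0 ht; have [Ly' _ _] := Ly; move: t0; rewrite le_eqVlt => /predU1P[t0|t0].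
  have [v hv] := ht (esym t0); exists v; apply: lt0r_neq0.
  by rewrite ltr_wpDl ?lower_ge0 // lt_max -t0 subr0 hv orbT.
have yf := Lc.1 _ Ly'.
exists (c (supp y)); apply: lt0r_neq0; rewrite ltr_pwDl ?le_max ?lexx //.
apply: lower_apex_gt0 => //; first exact: realization_unit_valued.
  exact: ltW.
by apply: level_supp_gt0 => //; [exact: L_neq0|exact: realization_unit_valued].
Qed.

(** A level is an infimum over pairs of vertices, so [Y] must converge uniformly; for [H] pointwise
    convergence suffices. *)
Lemma cvg_blend {I : Type} (F : set_system I) (Y H : I -> R -> R) (S : I -> R)
  (y h : R -> R) (t : R) (W : set R) (v : R) :
  Filter F -> finite_set W -> realization L y -> supp y `<=` W -> 0 <= t ->
  (\forall p \near F, [/\ realization L (Y p), supp (Y p) `<=` W & 0 <= S p]) ->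
  ucvg F Y y -> (forall v, H p v @[p --> F] --> h v) -> S @ F --> t ->
  blend (Y p) (H p) (S p) v @[p --> F] --> blend y h t v.
Proof.
move=> FF Wf Ly yW t0 YW Yy Hh St; apply: cvgD.
  rewrite (lowerE W) //; last exact: realization_unit_valued.
  set r := fset_set _.
  apply: (@cvg_trans _ ((fun p => \sum_(B <- r) level B (Y p) (S p)) @ F)).
    apply: near_eq_cvg; apply: filterS YW => p [LY ? ?].
    by rewrite (lowerE W) //; exact: realization_unit_valued.
  apply: cvg_sum_seq => B.
  rewrite in_fset_set ?inE => [[_ LB _]|].
    apply: cvg_level => //; [exact: L_neq0|exact: realization_unit_valued|].
    by apply: filterS YW => p [LY ? ?]; split => //; exact: realization_unit_valued.
  by apply: sub_finite_set (finite_powerset W Wf) => ? [].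
under eq_cvg do rewrite maxr_absE.
rewrite maxr_absE; apply: cvgM; last exact: cvg_cst.
have cHS : H p v - S p @[p --> F] --> h v - t by apply: cvgB.
apply: cvgD; first by apply: cvgD => //; exact: cvg_cst.
by apply: cvg_norm; apply: cvgB => //; exact: cvg_cst.
Qed.

Lemma cvg_normalize_blend {I : Type} (F : set_system I) (Y H : I -> R -> R)
  (S : I -> R) (y h : R -> R) (t : R) (W V : set R) (v : R) :
  Filter F -> finite_set W -> finite_set V ->
  realization L y -> supp y `<=` W -> 0 <= t -> (forall v, 0 <= h v) ->
  supp h `<=` V -> supp (blend y h t) !=set0 ->
  (\forall p \near F, [/\ realization L (Y p), supp (Y p) `<=` W & 0 <= S p]) ->
  (\forall p \near F, (forall v, 0 <= H p v) /\ supp (H p) `<=` V) ->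
  ucvg F Y y -> (forall v, H p v @[p --> F] --> h v) -> S @ F --> t ->
  normalize (blend (Y p) (H p) (S p)) v @[p --> F] --> normalize (blend y h t) v.
Proof.
move=> FF Wf Vf Ly yW t0 h0 hV bn YW HV Yy Hh St.
pose U := V `|` [set c B | B in [set B | B `<=` W]].
have Uf : finite_set U.
  by rewrite finite_setU; split => //; apply: finite_image; exact: finite_powerset.
have bU y' h' t' : realization L y' -> supp y' `<=` W -> 0 <= t' ->
    (forall v, 0 <= h' v) -> supp h' `<=` V -> supp (blend y' h' t') `<=` U.
  move=> Ly' yW' t0' h0' hV' u.
  move/(blend_supp _ _ _ (realization_unit_valued _ Ly') t0' h0').
  by case => [/hV'|[B /= By <-]]; [left|right; exists B => //; exact: subset_trans yW'].
apply: (cvg_normalize _ _ _ U) => //.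
- exact: bU.
- by apply: filterS2 YW HV => p [? ? ?] [? ?]; exact: bU.
- by move=> u; apply: (cvg_blend _ _ _ _ _ _ _ W).
- rewrite gt_eqF //; apply: sum_support_gt0 => //; last exact: blend_ge0.
  by apply: sub_finite_set Uf; exact: bU.
Qed.

(** Coordinates are at most 1, so [t = 1] counts all levels; with [h = 0] only the apexes carry
    weight. *)
Definition section (y : R -> R) : R -> R := normalize (blend y (fun=> 0) 1).

Lemma blend1_neq0 y : realization L y -> supp (blend y (fun=> 0) 1) !=set0.
Proof. by move=> Ly; apply: blend_supp_neq0 => // /eqP; rewrite oner_eq0. Qed.

Let supp0 : supp (fun=> 0 : R) = set0.
Proof. by apply/seteqP; split => v //=; rewrite /supp /= eqxx. Qed.

Lemma section_realization y : realization L y -> realization K (section y).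
Proof.
move=> Ly; have bn := blend1_neq0 y Ly.
apply: normalize_realization => //; last exact: blend_ge0.
apply: blend_face => //; first by left.
by move=> v; case: Ly.
Qed.

Lemma section_supp y : realization L y ->
  supp (section y) `<=` [set c B | B in [set B | L B /\ B `<=` supp y]].
Proof.
move=> Ly v /normalize_supp; rewrite /supp /blend /=.
rewrite sub0r max_l ?addr0 ?oppr_le0 // => /lower_neq0[B [LB <- lB]].
exists B => //=; split => //; apply: level_gt0_supp lB => //; first exact: L_neq0.
exact: realization_unit_valued.
Qed.

Let section_supp_image y A : realization L y -> supp y `<=` A ->
  supp (section y) `<=` [set c B | B in [set B | B `<=` A]].
Proof.
move=> Ly yA v /(section_supp _ Ly)[B /= [_ By] <-].
by exists B => //=; exact: subset_trans yA.
Qed.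

Lemma cvg_section A y t v : L A -> realization L y -> supp y `<=` A ->
  section p.1 v @[p --> cell_nbhs L A y t] --> section y v.
Proof.
move=> LA Ly yA; have Af := Lc.1 _ LA.
apply: (cvg_normalize_blend _ _ _ _ _ _ _ A set0) => //.
- by rewrite supp0.
- exact: blend1_neq0.
- by apply: filterS (cell_nbhsT L A y t) => p [? ? _]; split.
- by apply: filterE => p; rewrite supp0; split.
- exact: ucvg_cell_fst.
- by move=> u; exact: cvg_cst.
- exact: cvg_cst.
Qed.

Lemma cell_continuous_section : cell_continuous L K (fun y _ => section y).
Proof.
split=> [y t Ly _|A LA]; first exact: section_realization.
exists [set c B | B in [set B | B `<=` A]].
  by apply: finite_image; apply: finite_powerset; exact: Lc.1.
move=> y t Ly yA _; split; first exact: section_supp_image.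
by move=> v; exact: cvg_section.
Qed.

(* At time 0 this is [h], at time 1 it is the section of the image of [h]. *)
Definition collapse (h : R -> R) (t : R) : R -> R :=
  normalize (blend (realize_map phi h) h t).

Let realL := realize_map_realization K L phi Kc phiS.

Let blend_collapse_neq0 h t : realization K h -> 0 <= t ->
  supp (blend (realize_map phi h) h t) !=set0.
Proof.
move=> Kh t0; have [Kh' h0 h1] := Kh; apply: blend_supp_neq0 => //; first exact: realL.
move=> _; apply: contrapT => /forallNP nh.
suff h_0 : \sum_(v \in [set: R]) h v = 0.
  by move: h1; rewrite h_0 => /esym/eqP; rewrite oner_eq0.
apply: fsbig1 => v _; apply/eqP; rewrite eq_le h0 andbT leNgt.
exact/negP/nh.
Qed.

Lemma collapse_realization h t : realization K h -> 0 <= t ->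
  realization K (collapse h t).
Proof.
move=> Kh t0; have [Kh' h0 h1] := Kh; have bn := blend_collapse_neq0 h t Kh t0.
apply: normalize_realization => //; last exact: blend_ge0.
apply: blend_face => //; [exact: realL|by right|].
by move=> v; apply: realize_map_ge => //; exact: Kc.1.
Qed.

Lemma collapse0 h : realization K h -> collapse h 0 = h.
Proof.
move=> Kh; rewrite /collapse; suff -> : blend (realize_map phi h) h 0 = h.
  exact: (normalize_id K).
apply/funext => v; rewrite /blend subr0 max_r; last by case: Kh.
have [->|/lower_neq0[B [LB _ lB]]] := eqVneq (lower (realize_map phi h) 0 v) 0.
  exact: add0r.
have [b Bb] := L_neq0 B LB.
(* A positive level at [t = 0] would require [0 < Num.min 0 (y b)]. *)
have := level_gt0P B _ 0 b b (L_neq0 B LB) (realization_unit_valued _ (realL _ Kh))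
  (lexx 0) lB Bb.
by rewrite mem_set // lt_min ltxx.
Qed.

(** Coordinates are at most 1, so the part [(h - 1)^+] vanishes. *)
Lemma collapse1 h : realization K h -> collapse h 1 = section (realize_map phi h).
Proof.
move=> Kh; congr normalize; apply/funext => v; rewrite /blend; congr (_ + _).
by rewrite !max_l // ?subr_le0 ?ler01 //; exact: (realization_le1 K).
Qed.

(** Time is reversed because the homotopy has to end at the identity, which is [collapse] at time
    0. *)
Lemma cell_continuous_collapse : cell_continuous K K (fun h t => collapse h (1 - t)).
Proof.
split=> [h t Kh /andP[_ t1]|A KA]; first by apply: collapse_realization => //; rewrite subr_ge0.
have Af := Kc.1 _ KA; have pAf : finite_set (phi @` A) by exact: finite_image.
exists (A `|` [set c B | B in [set B | B `<=` phi @` A]]).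
  by rewrite finite_setU; split => //; apply: finite_image; exact: finite_powerset.
move=> h t Kh hA t01; have t10 : 0 <= 1 - t by case/andP: t01 => _; rewrite subr_ge0.
have Lh := realL _ Kh; have [_ h0 _] := Kh.
have phA x : supp x `<=` A -> supp (realize_map phi x) `<=` phi @` A.
  by move=> xA w /realize_map_supp[u /xA Au <-]; exists u.
split=> [v /normalize_supp|v].
  move/(blend_supp _ _ _ (realization_unit_valued _ Lh) t10 h0).
  case=> [/hA|[B /= Bh <-]]; [by left|right; exists B => //=].
  by apply: subset_trans Bh _; exact: phA.
have cT := cell_nbhsT K A h t.
have cv u : p.1 u @[p --> cell_nbhs K A h t] --> h u.
  by apply: ucvg_cvg; exact: ucvg_cell_fst.
apply: (cvg_normalize_blend _ _ _ _ _ _ _ (phi @` A) A) => //.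
- exact: phA.
- exact: blend_collapse_neq0.
- apply: filterS cT => p [Kp pA /andP[_ p1]]; split; [exact: realL|exact: phA|].
  by rewrite subr_ge0.
- by apply: filterS cT => p [[_ ? _] pA _].
- apply: (ucvg_finite _ _ _ (phi @` A)) => //; first exact: phA.
    by apply: filterS cT => p [_ pA _]; exact: phA.
  move=> w _; apply: (cvg_realize_map _ _ _ _ A) => //.
  by apply: filterS cT => p [].
- by apply: cvgB; [exact: cvg_cst|exact: cvg_cell_snd].
Qed.

(** Each apex used by [section y] lies over a face contained in [supp y]. The straight segment from
    the image back to [y] therefore stays in one closed simplex. *)
Lemma realize_section_supp y : realization L y ->
  supp (realize_map phi (section y)) `<=` supp y.
Proof.
move=> Ly w /realize_map_supp[_ /(section_supp _ Ly)[B [LB By] <-] <-].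
by apply: By; exact: apex_over.
Qed.

Lemma cell_continuous_segment : cell_continuous L L
  (fun y t => (fun v => (1 - t) * realize_map phi (section y) v + t * y v)).
Proof.
split=> [y t Ly t01|A LA].
  apply: segment_realization => //; last exact: realize_section_supp.
  by apply: realL; exact: section_realization.
have Af := Lc.1 _ LA; exists A => // y t Ly yA t01; split => [v|v].
  apply: contraPP => nA; rewrite /supp /=.
  have -> : realize_map phi (section y) v = 0.
    by apply: contra_notP nA => /eqP /(realize_section_supp _ Ly) /yA.
  have -> : y v = 0 by apply: contra_notP nA => /eqP /yA.
  by rewrite !mulr0 addr0 eqxx.
have cS : p.2 @[p --> cell_nbhs L A y t] --> t by exact: cvg_cell_snd.
apply: cvgD; apply: cvgM => //.
- by apply: cvgB => //; exact: cvg_cst.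
- apply: (cvg_realize_map _ _ _ _ [set c B | B in [set B | B `<=` A]]).
  + by apply: finite_image; exact: finite_powerset.
  + exact: section_supp_image.
  + by apply: filterS (cell_nbhsT L A y t) => p [? ? _]; exact: section_supp_image.
  + by move=> u; exact: cvg_section.
- by apply: ucvg_cvg; exact: ucvg_cell_fst.
Qed.

Theorem cone_fibres_homotopy_equivalence :
  cw_homotopy_equivalence K L (realize_map phi).
Proof.
(* The two maps are families constant in time, evaluated at time 0. *)
have i0 : 0 <= (0 : R) <= 1 by rewrite lexx ler01.
split.
  exact: (cell_continuous_cw K L _ 0 Lc i0 (cell_continuous_realize_map _ _ _ Kc phiS)).
exists section; split.
- exact: (cell_continuous_cw L K _ 0 Kc i0 cell_continuous_section).
- apply: (cell_continuous_homotopic _ _ _ _ _ Kc cell_continuous_collapse) => x Kx.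
    by rewrite subr0 collapse1.
  by rewrite subrr collapse0.
- apply: (cell_continuous_homotopic _ _ _ _ _ Lc cell_continuous_segment) => y Ly;
    apply/funext => v /=.
    by rewrite subr0 mul1r mul0r addr0.
  by rewrite subrr mul0r mul1r add0r.
Qed.

End Fibre.

(** * Arc length, and the two complexes on the circle *)

Section Circle.
Context {R : realType}.
Implicit Types (x y s r : R) (X Y A : set R).

Lemma mod1_id x : 0 <= x < 1 -> mod1 x = x.
Proof. by move=> x01; rewrite /mod1 (@floor_def _ x 0) ?subr0 // add0r. Qed.

Lemma mod1D1 x : 0 <= x < 1 -> mod1 (x + 1) = x.
Proof.
move=> /andP[x0 x1]; rewrite /mod1 (@floor_def _ (x + 1) 1); first lra.
by rewrite intrD; apply/andP; split; lra.
Qed.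

Lemma circ_distC x y : circ_dist x y = circ_dist y x.
Proof. by rewrite /circ_dist distrC. Qed.

Lemma circ_dist_le x y s : circ_dist x y <= s <->
  `|x - y| <= s \/ (1 - s <= x - y \/ 1 - s <= y - x).
Proof.
rewrite /circ_dist ge_min lerBlDl -lerBlDr ler_normr opprB.
split; first by move=> /orP[|/orP[]]; auto.
by move=> [->//|[]->]; rewrite ?orbT.
Qed.

Lemma VR_is_complex Y s : is_complex (VR Y s).
Proof.
split => [A []//|A B [Af _ AY As] BA B0]; split => //.
- exact: sub_finite_set Af.
- exact: subset_trans AY.
- by move=> x y /BA ? /BA ?; exact: As.
Qed.

Lemma Cech_is_complex X r : is_complex (Cech X r).
Proof.
split => [A []//|A B [Af _ AX [p [p1 Ap]]] BA B0]; split => //.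
- exact: sub_finite_set Af.
- exact: subset_trans AX.
- by exists p; split => // x /BA /Ap.
Qed.

(** * The stretched circle and the fibres of [pi_r] *)

Section Unrolled.
Variables (r : R) (X : set R).
Hypotheses (XC : X `<=` @on_circle R) (r01 : 0 < r < 1 / 2).

Let c := 1 + 2 * r.
Let c0 : 0 < c. Proof. by case/andP: r01 => ? _; rewrite /c; lra. Qed.

(* Here [u] is a point of the circle [0, 1 + 2 r) of circumference [1 + 2 r],
   obtained by stretching the circle that carries [T_r r X]. *)
Definition lies_over x u := u = x \/ (x < 2 * r /\ u = x + 1).

(** Reduction modulo 1 acts trivially in [T_r]: before rescaling, its points are [x < 1] and [x + 1]
    with [x < 2 * r], all in [[0, 1 + 2 * r)]. *)
Lemma T_rP y : T_r r X y <-> exists2 x, X x & lies_over x (c * y).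
Proof.
have /andP[r0 r1] := r01.
have cV x : 0 <= x < c -> mod1 (c^-1 * x) = c^-1 * x.
  move=> /andP[x0 xc]; apply: mod1_id.
  apply/andP; split; first by rewrite mulr_ge0 // invr_ge0 ltW.
  by rewrite mulrC ltr_pdivrMr // mul1r.
have cK x : c * (c^-1 * x) = x by rewrite mulrA divff ?mul1r // gt_eqF.
have E x : c^-1 * x + c^-1 = c^-1 * (x + 1) by rewrite mulrDr mulr1.
split.
- move=> [[x Xx <-]|[x [Xx [_ x2r]] <-]]; exists x => //; have [x0 x1] := XC _ Xx.
    by left; rewrite addr0 cV ?cK // /c; apply/andP; split; lra.
  right; split => //; rewrite -/c E cV ?cK //.
  by rewrite /c; apply/andP; split; lra.
- move=> [x Xx [cy|[x2r cy]]]; have [x0 x1] := XC _ Xx.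
    left; exists x => //; rewrite addr0 -/c cV ?/c; last by apply/andP; split; lra.
    by rewrite -/c -cy mulKf // gt_eqF.
  right; exists x => //; rewrite -/c E cV ?/c; last by apply/andP; split; lra.
  by rewrite -/c -cy mulKf // gt_eqF.
Qed.

Lemma pi_r_lift x y : X x -> lies_over x (c * y) -> pi_r r y = x.
Proof.
move=> Xx; have [x0 x1] := XC _ Xx; rewrite /pi_r -/c.
have x01 : 0 <= x < 1 by rewrite x0.
by move=> [->|[_ ->]]; [exact: mod1_id|exact: mod1D1].
Qed.

Lemma T_r_lift x y : T_r r X y -> pi_r r y = x -> X x /\ lies_over x (c * y).
Proof. by move=> /T_rP[x' Xx' h] <-; rewrite (pi_r_lift x'). Qed.

Lemma T_r_point x u : X x -> lies_over x u -> T_r r X (u / c) /\ pi_r r (u / c) = x.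
Proof.
move=> Xx xu; have h : lies_over x (c * (u / c)) by rewrite mulrC divfK // gt_eqF.
by split; [apply/T_rP; exists x|exact: pi_r_lift].
Qed.

Lemma pi_r_image : pi_r r @` T_r r X = X.
Proof.
apply/seteqP; split => [_ [y /T_r_lift h <-]|x Xx]; first by case: (h _ erefl).
by have [h1 h2] := T_r_point x x Xx (or_introl erefl); exists (x / c).
Qed.

(** The arc complementary to one of length [2 * r / c] has length [1 / c]; multiplying by [c] gives
    the thresholds [2 * r] and 1. *)
Lemma T_r_adjacent y z : circ_dist y z <= 2 * r / c <->
  `|c * y - c * z| <= 2 * r \/ (1 <= c * y - c * z \/ 1 <= c * z - c * y).
Proof.
have /andP[r0 r1] := r01.
have E : 1 - 2 * r / c = 1 / c.
  by rewrite -[X in X - _](divff (lt0r_neq0 c0)) -mulrBl; congr (_ / _); rewrite /c; lra.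
rewrite circ_dist_le E -!mulrBr normrM (gtr0_norm c0) ler_pdivlMr //.
by rewrite !ler_pdivrMr // ![_ * c]mulrC.
Qed.

(* Each point of [A] has a lift [x] or [x + 1] in [p, p + 2 r];
   [p <= x + 1] is automatic. *)
Lemma Cech_arc A : Cech X r A <-> [/\ finite_set A, A !=set0, A `<=` X &
  exists p, 0 <= p < 1 /\
    forall x, A x -> (p <= x <= p + 2 * r) \/ (x + 1 <= p + 2 * r)].
Proof.
have /andP[r0 r1] := r01.
split=> -[Af A0 AX [p [p01 Ap]]]; split => //.
  (* The arc starts [r] before the centre [p], at [p - r] or, after wrapping, at [p - r + 1]. *)
  have [p0 p1] := p01; have [pr|pr] := leP r p.
    exists (p - r); split; first by apply/andP; split; lra.
    move=> x Ax; have [x0 x1] := XC _ (AX _ Ax).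
    have /circ_dist_le := Ap x Ax; rewrite ler_norml => -[/andP[? ?]|[?|?]].
    - by left; apply/andP; split; lra.
    - by exfalso; lra.
    - by right; lra.
  exists (p - r + 1); split; first by apply/andP; split; lra.
  move=> x Ax; have [x0 x1] := XC _ (AX _ Ax).
  have /circ_dist_le := Ap x Ax; rewrite ler_norml => -[/andP[? ?]|[?|?]].
  - by right; lra.
  - by left; apply/andP; split; lra.
  - by exfalso; lra.
(* Conversely the centre is the midpoint [p + r], reduced modulo 1. *)
have /andP[p0 p1] := p01; have [pr|pr] := ltP (p + r) 1.
  exists (p + r); split; first by split; lra.
  move=> x Ax; have [x0 x1] := XC _ (AX _ Ax); apply/circ_dist_le.
  have [/andP[? ?]|?] := Ap x Ax; last by right; right; lra.
  by left; rewrite ler_norml; apply/andP; split; lra.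
exists (p + r - 1); split; first by split; lra.
move=> x Ax; have [x0 x1] := XC _ (AX _ Ax); apply/circ_dist_le.
have [/andP[? ?]|?] := Ap x Ax; first by right; left; lra.
by left; rewrite ler_norml; apply/andP; split; lra.
Qed.

(* The image of a face lies in the arc of length [2 r] starting at the image
   of its first vertex. *)
Lemma pi_r_simplicial : simplicial (VR (T_r r X) (2 * r / c)) (Cech X r) (pi_r r).
Proof.
have /andP[r0 r1] := r01.
move=> A [Af A0 AT Ad].
have AX y : A y -> X (pi_r r y) /\ lies_over (pi_r r y) (c * y).
  by move=> /AT Ty; exact: T_r_lift.
apply/Cech_arc; split; first exact: finite_image.
- by case: A0 => y Ay; exists (pi_r r y); exists y.
- by move=> _ [y /AX[? _] <-].
(* With [m] first on the stretched circle, every other vertex is at most [2 * r] or at least 1 after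
   it. *)
have [m Am mmin] := finite_argmin A (fun y => c * y) Af A0.
have [Xm lm] := AX m Am; have [m0 m1] := XC _ Xm.
exists (pi_r r m); split; first by rewrite m0.
move=> _ [y Ay <-]; have [Xy ly] := AX y Ay; have [y0 y1] := XC _ Xy.
have := mmin y Ay; have := Ad y m Ay Am; move/T_r_adjacent; rewrite ler_norml.
move: lm ly; rewrite /lies_over; set a := pi_r r m in m0 m1 *; set b := pi_r r y in y0 y1 *.
move=> [->|[? ->]] [->|[? ->]] [/andP[? ?]|[?|?]] ?;
  (try by exfalso; lra);
  (try by left; apply/andP; split; lra); by right; lra.
Qed.

(* The apex is the first point of [A] on the arc [p, p + 2 r], unless that
   point lies beyond [2 r] and the arc wraps around; then it is the second
   lies_over of the last point of the arc. *)
Lemma fibre_apex A : Cech X r A -> exists a, [/\ T_r r X a, A (pi_r r a) &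
  forall y, T_r r X y -> A (pi_r r y) -> circ_dist y a <= 2 * r / c].
Proof.
have /andP[r0 r1] := r01.
move=> /Cech_arc[Af A0 AX [p [/andP[p0 p1] Ap]]].
suff [x Ax [u xu h]] : exists2 x, A x & exists2 u, lies_over x u &
    forall z v, A z -> lies_over z v ->
      `|v - u| <= 2 * r \/ (1 <= v - u \/ 1 <= u - v).
  have [Tu pu] := T_r_point x u (AX _ Ax) xu; exists (u / c); rewrite pu; split => //.
  move=> y Ty Ay; apply/T_r_adjacent; rewrite [c * (u / c)]mulrC divfK ?gt_eqF //.
  by apply: (h _ _ Ay); case: (T_r_lift _ _ Ty erefl).
have Cz z : A z -> 0 <= z < 1 by move=> /AX/XC[-> ->].
(* [A2] is the part of the arc before the wrap at 1, and [A1] the part after it. *)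
pose A1 := A `&` [set x | x < p]; pose A2 := A `&` [set x | p <= x].
have Af1 : finite_set A1 by exact: finite_setIl.
have Af2 : finite_set A2 by exact: finite_setIl.
have [A20|/set0P A2n] := eqVneq A2 set0.
  have [m Am mmin] := finite_argmin A id Af A0; exists m => //; exists m; first by left.
  (* Every point has wrapped, so [z + 1 <= p + 2 * r < 1 + 2 * r]. *)
  have small z : A z -> z < 2 * r.
    move=> Az; have [/andP[pz _]|] := Ap z Az; last by lra.
    by have : A2 z by []; rewrite A20.
  move=> z v Az lv; have := mmin z Az; have := small z Az; have := small m Am.
  have /andP[? ?] := Cz z Az; have /andP[? ?] := Cz m Am => /= ? ? ?.
  case: lv => [->|[_ ->]]; last by right; left; lra.
  by left; rewrite ler_norml; apply/andP; split; lra.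
have [m [Am pm] mmin] := finite_argmin A2 id Af2 A2n; rewrite /= in pm mmin.
have /andP[m0 m1] := Cz m Am.
have upper z : A z -> p <= z -> z <= p + 2 * r.
  by move=> Az pz; case: (Ap z Az) => [/andP[]//|]; lra.
have wrap z : A z -> z < p -> z + 1 <= p + 2 * r.
  by move=> Az zp; case: (Ap z Az) => [/andP[]|//]; lra.
(* Lifts of points from [p] on lie within [2 * r] of [m] or at least 1 after it. A wrapped point has
   its second lift within [2 * r] after [m]; its first lift precedes [m] and is within [2 * r] when
   [m <= 2 * r]. *)
have m_apex : m <= 2 * r \/ A1 = set0 -> forall z v, A z -> lies_over z v ->
    `|v - m| <= 2 * r \/ (1 <= v - m \/ 1 <= m - v).
  move=> hm z v Az lv; have /andP[? ?] := Cz z Az; have [pz|zp] := leP p z.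
    have ? := mmin z (conj Az pz); have ? := upper z Az pz.
    case: lv => [->|[_ ->]]; last by right; left; lra.
    by left; rewrite ler_norml; apply/andP; split; lra.
  have ? := wrap z Az zp.
  case: hm => [?|A10]; last by have : A1 z by []; rewrite A10.
  by left; case: lv => [->|[_ ->]]; rewrite ler_norml; apply/andP; split; lra.
have [m2|m2] := leP m (2 * r).
  by exists m => //; exists m; [left|apply: m_apex; left].
have [A10|/set0P A1n] := eqVneq A1 set0.
  by exists m => //; exists m; [left|apply: m_apex; right].
have [M [AM Mp] Mmax] := finite_argmin A1 -%R Af1 A1n; rewrite /= in Mp Mmax.
have /andP[M0 M1] := Cz M AM; have Mw := wrap M AM Mp.
(* From [M + 1 <= p + 2 * r] and [p < 1] follows [M < 2 * r], so the second lift [M + 1] exists. *)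
exists M => //; exists (M + 1); first by right; split; lra.
move=> z v Az lv; have /andP[? ?] := Cz z Az; have [pz|zp] := leP p z.
  have ? := mmin z (conj Az pz); have ? := upper z Az pz.
  (* A second lift is excluded by [z >= m > 2 * r]. *)
  case: lv => [->|[? ->]]; last by exfalso; lra.
  by left; rewrite ler_norml; apply/andP; split; lra.
have := Mmax z (conj Az zp); rewrite lerN2 => ?; have ? := wrap z Az zp.
(* Since [z <= M], the first lift is at least 1 before [M + 1], and the second is at most
   [M < 2 * r] before it. *)
case: lv => [->|[_ ->]]; first by right; right; lra.
by left; rewrite ler_norml; apply/andP; split; lra.
Qed.

End Unrolled.
End Circle.

Theorem theorem9p3 (R : realType) (X : set R) (r : R) :
  X `<=` @on_circle R -> 0 < r -> r < 1 / 2 ->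
  [/\ pi_r r @` T_r r X = X,
      simplicial (VR (T_r r X) (2 * r / (1 + 2 * r))) (Cech X r) (pi_r r) &
      cw_homotopy_equivalence (VR (T_r r X) (2 * r / (1 + 2 * r))) (Cech X r)
        (realize_map (pi_r r))].
Proof.
move=> XC r0 r1; set K := VR _ _; have r01 : 0 < r < 1 / 2 by rewrite r0 r1.
have simp : simplicial K (Cech X r) (pi_r r) by exact: pi_r_simplicial.
split => //; first exact: pi_r_image.
(* Apexes are chosen for all sets at once, with 0 as the value off the Cech complex. *)
have : forall B, exists a, Cech X r B -> [/\ T_r r X a, B (pi_r r a) &
    forall y, T_r r X y -> B (pi_r r y) -> circ_dist y a <= 2 * r / (1 + 2 * r)].
  move=> B; have [/fibre_apex[]// a|] := pselect (Cech X r B); last by exists 0.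
  by exists a.
move=> /choice[c hc].
apply: (cone_fibres_homotopy_equivalence K (Cech X r) (pi_r r) c) => //.
- exact: VR_is_complex.
- exact: Cech_is_complex.
- by move=> B /hc[].
move=> A B /hc[Tc Bc adj] KA AB.
(* The empty set satisfies these conditions vacuously, which merges the two cases of [KA]. *)
have [Af AT Ad] : [/\ finite_set A, A `<=` T_r r X &
    forall x y, A x -> A y -> circ_dist x y <= 2 * r / (1 + 2 * r)].
  by case: KA => [->|[? ? ? ?]]; split.
have adjA y : A y -> circ_dist y (c B) <= 2 * r / (1 + 2 * r).
  by move=> Ay; apply: adj; [exact: AT|apply: AB; exists y].
split.
- by rewrite finite_setU; split => //; exact: finite_set1.
- by exists (c B); right.
- by move=> y [/AT//|->].
- move=> x y [Ax|->] [Ay|->]; [exact: Ad|exact: adjA| |exact: adj].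
  by rewrite circ_distC; exact: adjA.
Qed.
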